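(* Let $F,F_z\in\mathbb{R}^{3\times 3}$. Let $R$ be a random element of $\mathsf{SO(3)}$ with $R\sim\mathcal{M}(F)$, and let the attitude measurement be $R_z=RW_R\in\mathsf{SO(3)}$, where the measurement error $W_R\in\mathsf{SO(3)}$ is independent of $R$ and $W_R\sim\mathcal{M}(F_z)$. Then the posterior distribution of $R$ given the measurement $R_z$ is the matrix Fisher distribution with matrix parameter $F+R_zF_z^T$; that is, its density with respect to $dR$ is \[ p(R\mid R_z)=\frac{1}{c(F+R_zF_z^T)}\exp\!\left(\mathrm{tr}\!\left[(F+R_zF_z^T)^TR\right]\right), \] i.e. $R\mid R_z\sim\mathcal{M}(F+R_zF_z^T)$.
   Context: $\mathsf{SO(3)}=\{R\in\mathbb{R}^{3\times 3}\mid R^TR=I_{3\times 3},\ \det[R]=1\}$, and $dR$ denotes the Haar measure on $\mathsf{SO(3)}$ normalized so that $\int_{\mathsf{SO(3)}}dR=1$. The matrix Fisher distribution on $\mathsf{SO(3)}$ with matrix parameter $F\in\mathbb{R}^{3\times3}$, denoted $\mathcal{M}(F)$, has probability density $p(R)=\frac{1}{c(F)}\exp(\mathrm{tr}[F^TR])$ with respect to $dR$, where $c(F)=\int_{\mathsf{SO(3)}}\exp(\mathrm{tr}[F^TR])\,dR$. *)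

(* Defs.v *)
From HB Require Import structures.
From mathcomp Require Import all_boot all_order all_algebra.
From mathcomp Require Import all_classical all_reals all_analysis.

Set Implicit Arguments.
Unset Strict Implicit.
Unset Printing Implicit Defensive.

Import Order.TTheory GRing.Theory Num.Theory.
Import numFieldNormedType.Exports.

Local Open Scope classical_set_scope.
Local Open Scope ring_scope.

Record SO3 (R : realType) := MkSO3 {
  SO3_mx :> 'M[R]_3;
  SO3_mxP : (SO3_mx^T *m SO3_mx == 1%:M) && (\det SO3_mx == 1) }.

Section SO3_group.
Variable R : realType.
Implicit Types r s : SO3 R.

HB.instance Definition _ := [isSub for @SO3_mx R].
HB.instance Definition _ := [Choice of SO3 R by <:].

Lemma SO3_trmxK r : r^T *m r = 1%:M.
Proof. by case/andP: (SO3_mxP r) => /eqP. Qed.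

Lemma SO3_det r : \det r = 1.
Proof. by case/andP: (SO3_mxP r) => _ /eqP. Qed.

Lemma SO3_inj : injective (@SO3_mx R).
Proof. exact: val_inj. Qed.

Lemma SO3_oneP :
  ((1%:M : 'M[R]_3)^T *m 1%:M == 1%:M) && (\det (1%:M : 'M[R]_3) == 1).
Proof. by rewrite trmx1 mulmx1 det1 !eqxx. Qed.

Lemma SO3_mulP r s :
  ((r *m s)^T *m (r *m s) == 1%:M) && (\det (r *m s) == 1).
Proof.
rewrite det_mulmx !SO3_det mulr1 eqxx andbT.
by rewrite trmx_mul mulmxA -(mulmxA _ _ r) SO3_trmxK mulmx1 SO3_trmxK.
Qed.

Lemma SO3_invP r : (r^T^T *m r^T == 1%:M) && (\det r^T == 1).
Proof.
rewrite det_tr SO3_det eqxx andbT trmxK; apply/eqP.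
exact/mulmx1C/SO3_trmxK.
Qed.

Definition SO3_one : SO3 R := MkSO3 SO3_oneP.
Definition SO3_mul r s : SO3 R := MkSO3 (SO3_mulP r s).
Definition SO3_inv r : SO3 R := MkSO3 (SO3_invP r).

Lemma SO3_mulA : associative SO3_mul.
Proof. by move=> r s t; apply: SO3_inj; apply: mulmxA. Qed.

Lemma SO3_mul1 : left_id SO3_one SO3_mul.
Proof. by move=> r; apply: SO3_inj; apply: mul1mx. Qed.

Lemma SO3_mulr1 : right_id SO3_one SO3_mul.
Proof. by move=> r; apply: SO3_inj; apply: mulmx1. Qed.

Lemma SO3_mulV : left_inverse SO3_one SO3_inv SO3_mul.
Proof. by move=> r; apply: SO3_inj; apply: SO3_trmxK. Qed.

Lemma SO3_mulrV : right_inverse SO3_one SO3_inv SO3_mul.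
Proof. by move=> r; apply: SO3_inj; apply: mulmx1C; apply: SO3_trmxK. Qed.

HB.instance Definition _ := isGroup.Build (SO3 R)
  SO3_mulA SO3_mul1 SO3_mulr1 SO3_mulV SO3_mulrV.

End SO3_group.

(* The subspace topology inherited from 'M[R]_3, and its Borel sigma-algebra. *)
HB.instance Definition _ (R : realType) :=
  Topological.copy (SO3 R) (initial_topology (@SO3_mx R)).

HB.instance Definition _ (R : realType) := isPointed.Build (SO3 R) 1%g.

HB.instance Definition _ (R : realType) :=
  Measurable.copy (SO3 R) (g_sigma_algebraType (@open (SO3 R))).

(* The Haar measure of SO(3) with total mass 1: SO(3) being compact, it is the
   unique Borel probability measure invariant under left translations. *)
Definition is_haar (R : realType) (mu : probability (SO3 R) R) : Prop :=
  forall (g : SO3 R) (A : set (SO3 R)), measurable A ->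
    mu [set (g * r)%g | r in A] = mu A.

Section matrix_fisher.
Variables (R : realType) (mu : probability (SO3 R) R).

Definition fisher_const (F : 'M[R]_3) : R :=
  (\int[mu]_r expR (\tr (F^T *m SO3_mx r)))%R.

Definition fisher_pdf (F : 'M[R]_3) (r : SO3 R) : R :=
  (fisher_const F)^-1 * expR (\tr (F^T *m SO3_mx r)).

(* nu is the matrix Fisher distribution M(F). *)
Definition matrix_fisher (F : 'M[R]_3) (nu : set (SO3 R) -> \bar R) : Prop :=
  forall A : set (SO3 R), measurable A ->
    nu A = (\int[mu]_(r in A) (fisher_pdf F r)%:E)%E.

End matrix_fisher.

Section random_elements.
Context (d d1 d2 : measure_display) (Omega : measurableType d)
  (T1 : measurableType d1) (T2 : measurableType d2) (R : realType)
  (P : probability Omega R).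

Definition independent_RV (X : {RV P >-> T1}) (Y : {RV P >-> T2}) : Prop :=
  forall (A : set T1) (B : set T2), measurable A -> measurable B ->
    P (X @^-1` A `&` Y @^-1` B) = (P (X @^-1` A) * P (Y @^-1` B))%E.

(* K is a regular conditional distribution of X given Y: K y is the law of X
   conditionally on Y = y. *)
Definition conditional_distribution (X : {RV P >-> T1}) (Y : {RV P >-> T2})
    (K : R.-pker T2 ~> T1) : Prop :=
  forall (A : set T1) (B : set T2), measurable A -> measurable B ->
    P (X @^-1` A `&` Y @^-1` B) = (\int[distribution P Y]_(y in B) K y A)%E.

End random_elements.

(* Main.v *)
Require Import Defs.
From HB Require Import structures.
From mathcomp Require Import all_boot all_order all_algebra.
From mathcomp Require Import all_classical all_reals all_analysis.
From mathcomp Require Import measurable_realfun ring lra.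

Set Implicit Arguments.
Unset Strict Implicit.
Unset Printing Implicit Defensive.

Import Order.TTheory GRing.Theory Num.Theory.
Import numFieldNormedType.Exports.

(* Bayes' rule.  The law of (X, W) is a product, and substituting w = r^-1 z in
   the inner integral (left invariance of mu) shows that (X, Z) has density
   p_F(r) p_Fz(r^-1 z) with respect to mu x mu.  Since
   tr(Fz^T r^T z) = tr((z Fz^T)^T r), this density equals
   c(F)^-1 c(Fz)^-1 exp(tr((F + z Fz^T)^T r)), i.e. the matrix Fisher density
   with parameter F + z Fz^T times c(F + z Fz^T) / (c(F) c(Fz)); the latter
   factor is the density of Z. *)

Local Open Scope classical_set_scope.
Local Open Scope ring_scope.

(** * Measurability and boundedness on SO(3) *)

Definition rat_box (R : realType) m n (q : 'M[rat]_(m, n) * 'M[rat]_(m, n)) :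
    set 'M[R]_(m, n) :=
  [set M | forall i j, ratr (q.1 i j) < M i j < ratr (q.2 i j)].

(** Neighbourhoods of a matrix are entrywise, so each entry can be enclosed between two rationals
    within its own neighbourhood. The boxes are indexed by a countable type, so the union is
    countable. *)
Lemma open_mx_bigcup_rat_box (R : realType) m n (V : set 'M[R]_(m, n)) :
  open V -> V = \bigcup_(q in [set q | rat_box q `<=` V]) rat_box q.
Proof.
move=> oV; apply/seteqP; split=> [M VM|M [q qV]]; last exact: qV.
have [P MP PV] : nbhs M V by apply: open_nbhs_nbhs.
have /choice[q qP] (ij : 'I_m * 'I_n) : exists q : rat * rat,
    ratr q.1 < M ij.1 ij.2 < ratr q.2 /\
    (forall x, ratr q.1 < x < ratr q.2 -> P ij.1 ij.2 x).
  have /nbhs_ballP[e /= e0 eP] := MP ij.1 ij.2.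
  set c := M ij.1 ij.2 in eP *.
  have /rat_in_itvoo[a] : c - e < c by rewrite ltrBlDr ltrDl.
  have /rat_in_itvoo[b] : c < c + e by rewrite ltrDl.
  rewrite !in_itv /= => /andP[cb be] /andP[ea ac].
  exists (a, b); rewrite /= ac cb; split=> // x /andP[ax xb]; apply: eP.
  rewrite /ball /= ltr_norml; apply/andP; split; lra.
exists (\matrix_(i, j) (q (i, j)).1, \matrix_(i, j) (q (i, j)).2) => /=.
  move=> N qN; apply: PV => i j; apply: (qP (i, j)).2.
  by have := qN i j; rewrite !mxE.
by move=> i j; rewrite !mxE; exact: (qP (i, j)).1.
Qed.

(* Since open sets are countable unions of rational boxes, the Borel
   sigma-algebra of SO(3) is generated by the matrix entries; this is what makes
   multiplication measurable for the product sigma-algebra. *)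
Lemma measurable_to_SO3 (R : realType) (d : measure_display)
    (T : measurableType d) (f : T -> SO3 R) :
  (forall i j, measurable_fun setT (fun x => SO3_mx (f x) i j)) ->
  measurable_fun setT f.
Proof.
move=> mf; apply: (measurability (@open (SO3 R))) => //.
move=> _ [_ [V oV <-] <-]; rewrite setTI (open_mx_bigcup_rat_box oV).
(* The union is taken over all pairs of rational matrices, with the empty set for boxes not
   contained in [V], so that countability of the index type applies. *)
rewrite !preimage_bigcup bigcup_mkcond.
apply: countable_bigcupT_measurable => // q; case: ifP => // _.
rewrite [X in measurable X](_ : _ = \bigcap_(ij in [set: 'I_3 * 'I_3])
    ((fun x => SO3_mx (f x) ij.1 ij.2) @^-1`
      `]ratr (q.1 ij.1 ij.2), ratr (q.2 ij.1 ij.2)[)); last first.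
  apply/seteqP; split=> [x xq [i j] _|x xq i j].
    by rewrite /= in_itv; exact: xq.
  by have := xq (i, j) I; rewrite /= in_itv.
apply: fin_bigcap_measurable => [|[i j] _]; first exact: finite_finset.
by rewrite -[X in measurable X]setTI; exact: mf.
Qed.

Lemma measurable_SO3_entry (R : realType) (i j : 'I_3) :
  measurable_fun setT (fun r : SO3 R => SO3_mx r i j).
Proof.
apply: (measurability _ (RGenOpens.measurableE R)) => _ [_ [a [b ->]] <-].
rewrite setTI; apply: sub_sigma_algebra.
exists [set M : 'M[R]_3 | M i j \in `]a, b[] => //.
rewrite openE => M /= Mab.
(* A neighbourhood of [M] that constrains only the entry [(i, j)]. *)
exists (fun k l => if (k == i) && (l == j) then `]a, b[%classic else setT).
  move=> k l; case: ifPn => [/andP[/eqP -> /eqP ->]|_]; last exact: filterT.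
  by apply: open_nbhs_nbhs; split=> //; exact: interval_open.
by move=> N /(_ i j); rewrite !eqxx.
Qed.

Lemma measurable_mulmx (R : realType) (d : measure_display)
    (T : measurableType d) m n p
    (A : T -> 'M[R]_(m, n)) (B : T -> 'M[R]_(n, p)) :
  (forall i j, measurable_fun setT (fun x => A x i j)) ->
  (forall i j, measurable_fun setT (fun x => B x i j)) ->
  forall i j, measurable_fun setT (fun x => (A x *m B x) i j).
Proof.
move=> mA mB i j; under eq_fun do rewrite mxE.
by apply: measurable_sum => k; apply: measurable_funM.
Qed.

Lemma measurable_SO3_mul (R : realType) :
  measurable_fun setT (fun p : SO3 R * SO3 R => (p.1 * p.2)%g).
Proof.
apply: measurable_to_SO3; apply: measurable_mulmx => i j.
  exact: (measurableT_comp (measurable_SO3_entry i j) measurable_fst).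
exact: (measurableT_comp (measurable_SO3_entry i j) measurable_snd).
Qed.

Lemma measurable_SO3_inv (R : realType) :
  measurable_fun setT (fun r : SO3 R => (r^-1)%g).
Proof.
apply: measurable_to_SO3 => i j; under eq_fun do rewrite mxE.
exact: measurable_SO3_entry.
Qed.

Lemma measurable_expR_tr (R : realType) (d : measure_display)
    (T : measurableType d) (A : T -> 'M[R]_3) (f : T -> SO3 R) :
  (forall i j, measurable_fun setT (fun x => A x i j)) ->
  measurable_fun setT f ->
  measurable_fun setT (fun x => expR (\tr ((A x)^T *m SO3_mx (f x)))).
Proof.
move=> mA mf; apply: measurableT_comp => //; apply: measurable_sum => i.
apply: measurable_mulmx => k l.
  by under eq_fun do rewrite mxE; exact: mA.
  exact: (measurableT_comp (measurable_SO3_entry k l) mf).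
Qed.

(** The diagonal entry [(j, j)] of [r^T r = 1] says that the squares in column [j] sum to 1. *)
Lemma SO3_entry_le1 (R : realType) (r : SO3 R) (i j : 'I_3) :
  `|SO3_mx r i j| <= 1.
Proof.
rewrite -(@ler_pXn2r _ 2)// ?nnegrE// expr1n real_normK ?num_real//.
have := congr1 (fun M : 'M[R]_3 => M j j) (SO3_trmxK r).
rewrite !mxE eqxx mulr1n => <-.
rewrite (bigD1 i)//= mxE -expr2 lerDl sumr_ge0// => k _.
by rewrite mxE -expr2 sqr_ge0.
Qed.

(** A bound uniform in [r]: the upper side makes the exponential integrable, the lower side makes
    [fisher_const] positive. *)
Lemma SO3_tr_bounded (R : realType) (F : 'M[R]_3) :
  exists b : R, forall r : SO3 R, `|\tr (F^T *m SO3_mx r)| <= b.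
Proof.
exists (\sum_i \sum_j `|F j i|) => r.
rewrite (le_trans (ler_norm_sum _ _ _))// ler_sum// => i _.
rewrite mxE (le_trans (ler_norm_sum _ _ _))// ler_sum// => j _.
by rewrite mxE normrM ler_piMr// SO3_entry_le1.
Qed.

(** * Integration tools: densities, translations, rectangles, kernels, joint laws *)

Local Open Scope ereal_scope.

(* By uniqueness of the Radon-Nikodym derivative, g may be replaced with the
   derivative of nu. *)
Lemma ge0_integral_density (R : realType) (d : measure_display)
    (T : measurableType d) (nu : {finite_measure set T -> \bar R})
    (mu : {sigma_finite_measure set T -> \bar R}) (g f : T -> \bar R) E :
  measurable_fun setT g -> (forall x, 0 <= g x) ->
  (forall A, measurable A -> nu A = \int[mu]_(x in A) g x) ->
  measurable E -> measurable_fun E f -> (forall x, 0 <= f x) ->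
  \int[nu]_(x in E) f x = \int[mu]_(x in E) (f x * g x).
Proof.
move=> mg g0 nuE mE mf f0.
have numu : nu `<< mu.
  apply/null_content_dominatesP => A mA muA; rewrite nuE//.
  by rewrite null_set_integral//; exact: measurable_funTS.
rewrite -(Radon_Nikodym_SigmaFinite.change_of_variables numu)//.
(* Uniqueness of the derivative needs integrable functions; the total integral of [g] is [nu setT],
   which is finite. *)
have ig : mu.-integrable setT g.
  apply/integrableP; split=> //; under eq_integral do rewrite gee0_abs//.
  by rewrite -nuE// ltey_eq fin_num_measure.
have mh := measurable_int _ (Radon_Nikodym_SigmaFinite.f_integrable numu).
apply: ae_eq_integral => //.
- by apply: emeasurable_funM => //; exact: measurable_funTS.
- by apply: emeasurable_funM => //; exact: measurable_funTS.
apply: ae_eqe_mul2l; apply: (ae_eq_subset (@subsetT _ E)).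
apply: integral_ae_eq => //.
- exact: Radon_Nikodym_SigmaFinite.f_integrable.
- by move=> A _ mA; rewrite -Radon_Nikodym_SigmaFinite.f_integral// nuE.
Qed.

(** The left side is an integral over [D] against the image of [mu] under translation by [g], and
    invariance identifies this image with [mu]. *)
Lemma haar_integral_mull (R : realType) (mu : probability (SO3 R) R)
    (g : SO3 R) (D : set (SO3 R)) (f : SO3 R -> \bar R) :
  is_haar mu -> measurable D -> measurable_fun setT f -> (forall r, 0 <= f r) ->
  \int[mu]_(r in [set r | D (g * r)%g]) f (g * r)%g = \int[mu]_(r in D) f r.
Proof.
move=> hmu mD mf f0.
have mg : measurable_fun setT (fun r : SO3 R => (g * r)%g).
  exact: (measurable_fun_pair2 g (@measurable_SO3_mul R)).
pose L : {mfun SO3 R >-> SO3 R} :=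
  HB.pack (fun r : SO3 R => (g * r)%g) (isMeasurableFun.Build _ _ _ _ _ mg).
transitivity (\int[pushforward mu L]_(r in D) f r).
  by rewrite (ge0_integral_pushforward mg)//; exact: measurable_funTS.
apply: eq_measure_integral => A mA _; rewrite /= /pushforward.
(* [is_haar] speaks of translated images, so it is applied to the preimage of [A], whose translate
   by [g] is [A] again. *)
rewrite -(hmu g); last first.
  by rewrite -[X in measurable X]setTI; exact: (mg measurableT).
congr (mu _); apply/seteqP; split=> [_ [r Ar <-]//|r Ar].
by exists (g^-1 * r)%g; rewrite /preimage /= mulVKg.
Qed.

Section integrals_on_rectangles.
Context (R : realType) (d1 d2 : measure_display) (T1 : measurableType d1)
  (T2 : measurableType d2).
Variable f : T1 * T2 -> \bar R.
Hypotheses (mf : measurable_fun setT f) (f0 : forall x, 0 <= f x).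

Let patch_XT (A : set T1) (B : set T2) x y :
  (f \_ (A `*` B)) (x, y) = ((fun x => (fun y => f (x, y)) \_ B) \_ A) x y.
Proof.
by rewrite [LHS]patchE in_setX patchE /=; case: (x \in A); rewrite ?patchE.
Qed.

Let mf_patch (A : set T1) (B : set T2) : measurable A -> measurable B ->
  measurable_fun setT (f \_ (A `*` B)).
Proof.
move=> mA mB; apply/(measurable_restrictT f); first exact: measurableX.
exact: measurable_funTS.
Qed.

Let f0_patch (A : set (T1 * T2)) x : 0 <= (f \_ A) x.
Proof. by rewrite patchE; case: ifP. Qed.

Lemma measurable_fun_integral_section
    (m2 : {sigma_finite_measure set T2 -> \bar R}) (B : set T2) :
  measurable B -> measurable_fun setT (fun x => \int[m2]_(y in B) f (x, y)).
Proof.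
move=> mB.
have := measurable_fun_fubini_tonelli_F (m2 := m2) _ (mf_patch measurableT mB)
  (f0_patch _).
congr measurable_fun; apply/funext => x; rewrite /fubini_F [RHS]integral_mkcond.
by apply: eq_integral => y _; rewrite patch_XT patch_setT.
Qed.

(** Tonelli on the whole product, applied to [f] extended by zero outside the rectangle [A] x [B];
    the sections of this extension are extensions by zero of the sections of [f]. *)
Lemma fubini_tonelli_rectangle
    (m1 : {sigma_finite_measure set T1 -> \bar R})
    (m2 : {sigma_finite_measure set T2 -> \bar R}) (A : set T1) (B : set T2) :
  measurable A -> measurable B ->
  \int[m1]_(x in A) \int[m2]_(y in B) f (x, y) =
  \int[m2]_(y in B) \int[m1]_(x in A) f (x, y).
Proof.
move=> mA mB.
have := fubini_tonelli (m1 := m1) (m2 := m2) _ (mf_patch mA mB) (f0_patch _).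
congr (_ = _); rewrite [RHS]integral_mkcond; apply: eq_integral => z _.
- rewrite patchE; case: ifPn => zA; [rewrite [RHS]integral_mkcond|].
    by apply: eq_integral => y _; rewrite patch_XT !patchE zA.
  by apply: integral0_eq => y _; rewrite patch_XT patchE (negbTE zA).
- rewrite patchE; case: ifPn => zB; [rewrite [RHS]integral_mkcond|].
    by apply: eq_integral => y _; rewrite patchE in_setX zB andbT patchE.
  by apply: integral0_eq => y _; rewrite patchE in_setX/= (negbTE zB) andbF.
Qed.

End integrals_on_rectangles.

(** Each [K x] is a measure by countable additivity of nonnegative integrals, [x |-> K x A] is
    measurable by Tonelli, and the total mass is 1 by assumption. *)
Lemma density_pkernel (R : realType) (d1 d2 : measure_display)
    (T1 : measurableType d1) (T2 : measurableType d2)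
    (mu : {sigma_finite_measure set T2 -> \bar R}) (f : T1 * T2 -> \bar R) :
  measurable_fun setT f -> (forall x, 0 <= f x) ->
  (forall x, \int[mu]_y f (x, y) = 1) ->
  exists K : R.-pker T1 ~> T2, forall x A, K x A = \int[mu]_(y in A) f (x, y).
Proof.
move=> mf f0 f1.
pose k x A := \int[mu]_(y in A) f (x, y).
have k0 x : k x set0 = 0 by rewrite /k integral_set0.
have k_ge0 x A : 0 <= k x A by exact: integral_ge0.
have k_add x : semi_sigma_additive (k x).
  move=> F mF tF mUF; apply: cvg_toP.
    apply: ereal_nondecreasing_is_cvgn => m n mn.
    exact: lee_sum_nneg_natr.
  rewrite /k ge0_integral_bigcup//; apply: measurable_funTS.
  exact: (measurable_fun_pair2 x mf).
pose K x : {measure set T2 -> \bar R} :=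
  HB.pack (k x) (isMeasure.Build _ _ _ (k x) (k0 x) (k_ge0 x) (@k_add x)).
have mK U : measurable U -> measurable_fun setT (K ^~ U).
  by move=> mU; exact: measurable_fun_integral_section.
pose Kk : R.-ker T1 ~> T2 := HB.pack K (isKernel.Build _ _ _ _ _ K mK).
have Kp := Kernel_isProbability.Build _ _ _ _ R Kk f1.
by exists (HB.pack_for (R.-pker T1 ~> T2) K (isKernel.Build _ _ _ _ _ K mK) Kp).
Qed.

(** Independence says that the law of [(X, Y)] agrees with the product of the marginals on
    rectangles, hence everywhere by uniqueness of the product measure, whose value at [S] is the
    integral of the sections. *)
Lemma independent_RV_joint (R : realType) (d d1 d2 : measure_display)
    (Omega : measurableType d) (T1 : measurableType d1) (T2 : measurableType d2)
    (P : probability Omega R) (X : {RV P >-> T1}) (Y : {RV P >-> T2})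
    (S : set (T1 * T2)) :
  independent_RV X Y -> measurable S ->
  P [set w | S (X w, Y w)] =
  \int[distribution P X]_x distribution P Y (xsection S x).
Proof.
move=> XY mS.
have mXY : measurable_fun setT (fun w => (X w, Y w)).
  exact: measurable_fun_pair.
pose XYm : {mfun Omega >-> (T1 * T2)%type} :=
  HB.pack (fun w => (X w, Y w)) (isMeasurableFun.Build _ _ _ _ _ mXY).
exact: (esym (product_measure_unique (m1 := distribution P X)
  (m2 := distribution P Y) (m' := pushforward P XYm) XY mS)).
Qed.

(** * Matrix Fisher densities and the pointwise Bayes identity *)

Section fisher.
Context (R : realType) (mu : probability (SO3 R) R).
Implicit Types F Fz : 'M[R]_3.

Let measurable_etr F :
  measurable_fun setT (fun r : SO3 R => expR (\tr (F^T *m SO3_mx r))).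
Proof. exact: measurable_expR_tr. Qed.

Let integrable_etr F :
  mu.-integrable setT (EFin \o (fun r : SO3 R => expR (\tr (F^T *m SO3_mx r)))).
Proof.
have [b Fb] := SO3_tr_bounded F.
apply: measurable_bounded_integrable => //.
  by rewrite ltey_eq fin_num_measure.
exists (expR b); split; first exact: num_real.
move=> M bM r _ /=; rewrite ger0_norm ?expR_ge0// (le_trans _ (ltW bM))//.
by rewrite ler_expR (le_trans (ler_norm _)).
Qed.

Lemma fisher_constE F :
  (fisher_const mu F)%:E = \int[mu]_r (expR (\tr (F^T *m SO3_mx r)))%:E.
Proof.
rewrite /fisher_const /Rintegral fineK// integrable_fin_num//.
exact: integrable_etr.
Qed.

(** The integrand is at least [expR (- b)] and [mu] has mass 1. *)
Lemma fisher_const_gt0 F : (0 < fisher_const mu F)%R.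
Proof.
have [b Fb] := SO3_tr_bounded F.
rewrite (lt_le_trans (expR_gt0 (- b)))// -lee_fin fisher_constE.
rewrite -[leLHS]mule1 -(probability_setT mu) -integral_cst//.
apply: ge0_le_integral => //.
- by move=> r _; rewrite lee_fin expR_ge0.
- exact/measurable_EFinP.
- by move=> r _; rewrite lee_fin ler_expR; case/ler_normlP: (Fb r) => ? _; lra.
Qed.

Lemma fisher_pdf_ge0 F r : (0 <= fisher_pdf mu F r)%R.
Proof. by rewrite mulr_ge0 ?invr_ge0 ?expR_ge0// ltW// fisher_const_gt0. Qed.

Lemma measurable_fisher_pdf F : measurable_fun setT (fisher_pdf mu F).
Proof. exact: measurable_funM. Qed.

Lemma integral_fisher_pdf F : \int[mu]_r (fisher_pdf mu F r)%:E = 1.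
Proof.
under eq_integral do rewrite EFinM.
rewrite ge0_integralZl//; [|exact/measurable_EFinP|..].
- by rewrite -fisher_constE -EFinM mulVf// gt_eqF// fisher_const_gt0.
- by rewrite lee_fin invr_ge0 ltW// fisher_const_gt0.
Qed.

Definition posterior_parameter F Fz (z : SO3 R) : 'M[R]_3 :=
  (F + SO3_mx z *m Fz^T)%R.

Let measurable_etr_posterior F Fz :
  measurable_fun setT (fun zr : SO3 R * SO3 R =>
    expR (\tr ((posterior_parameter F Fz zr.1)^T *m SO3_mx zr.2))).
Proof.
apply: measurable_expR_tr => // i j; under eq_fun do rewrite mxE.
apply: measurable_funD => //; apply: measurable_mulmx => // k l.
exact: (measurableT_comp (measurable_SO3_entry k l) measurable_fst).
Qed.

Lemma measurable_fisher_const_posterior F Fz :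
  measurable_fun setT (fun z => fisher_const mu (posterior_parameter F Fz z)).
Proof.
apply/measurable_EFinP; rewrite /comp; under eq_fun do rewrite fisher_constE.
apply: (measurable_fun_integral_section (f := fun zr : SO3 R * SO3 R =>
  (expR (\tr ((posterior_parameter F Fz zr.1)^T *m SO3_mx zr.2)))%:E)) => //.
  exact/measurable_EFinP.
Qed.

Lemma measurable_fisher_pdf_posterior F Fz :
  measurable_fun setT (fun zr : SO3 R * SO3 R =>
    fisher_pdf mu (posterior_parameter F Fz zr.1) zr.2).
Proof.
apply: measurable_funM => //.
(* The inverse of the positive normalizing constant is written as a real power, and power functions
   are measurable. *)
under eq_fun do rewrite -powR_inv1 ?ltW ?fisher_const_gt0//.
apply: (measurableT_comp (f := @powR R ^~ (-1)%R)) => //.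
exact: (measurableT_comp (measurable_fisher_const_posterior F Fz)
  measurable_fst).
Qed.

Definition measurement_pdf F Fz (z : SO3 R) : R :=
  (fisher_const mu (posterior_parameter F Fz z) /
   (fisher_const mu F * fisher_const mu Fz))%R.

Lemma measurement_pdf_ge0 F Fz z : (0 <= measurement_pdf F Fz z)%R.
Proof. by rewrite divr_ge0 ?mulr_ge0 ?ltW ?fisher_const_gt0. Qed.

Lemma measurable_measurement_pdf F Fz :
  measurable_fun setT (measurement_pdf F Fz).
Proof.
by apply: measurable_funM => //; exact: measurable_fisher_const_posterior.
Qed.

Lemma fisher_pdf_bayes F Fz (r z : SO3 R) :
  (fisher_pdf mu Fz (r^-1 * z)%g * fisher_pdf mu F r =
   fisher_pdf mu (posterior_parameter F Fz z) r * measurement_pdf F Fz z)%R.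
Proof.
rewrite /fisher_pdf /measurement_pdf.
have -> : SO3_mx (r^-1 * z)%g = (SO3_mx r)^T *m SO3_mx z by [].
have -> : \tr ((posterior_parameter F Fz z)^T *m SO3_mx r) =
    (\tr (Fz^T *m ((SO3_mx r)^T *m SO3_mx z)) + \tr (F^T *m SO3_mx r))%R.
  rewrite /posterior_parameter linearD/= mulmxDl mxtraceD addrC.
  congr (_ + _)%R.
  (* Transposing under the trace gives [r^T z Fz^T]; cycling then brings [Fz^T] to the front. *)
  by rewrite -mxtrace_tr !trmx_mul !trmxK mulmxA mxtrace_mulC mulmxA.
rewrite expRD.
have := lt0r_neq0 (fisher_const_gt0 F); have := lt0r_neq0 (fisher_const_gt0 Fz).
have := lt0r_neq0 (fisher_const_gt0 (posterior_parameter F Fz z)).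
move: (fisher_const _ _) (fisher_const _ _) (fisher_const _ _) => c1 c2 c3.
move: (expR _) (expR _) => e1 e2 h1 h2 h3.
field; rewrite ?h1 ?h2 ?h3//.
Qed.

End fisher.

(** * Joint law of state and measurement, and law of the measurement *)

Section bayes.
Context (R : realType) (mu : probability (SO3 R) R) (F Fz : 'M[R]_3)
  (d : measure_display) (Omega : measurableType d) (P : probability Omega R)
  (X W Z : {RV P >-> SO3 R}).
Hypotheses (hmu : is_haar mu) (hX : matrix_fisher mu F (distribution P X))
  (hW : matrix_fisher mu Fz (distribution P W)) (hXW : independent_RV X W)
  (hZ : forall w, Z w = (X w * W w)%g).

Lemma joint_law_measurement A B : measurable A -> measurable B ->
  P (X @^-1` A `&` Z @^-1` B) = \int[mu]_(z in B)
    (\int[mu]_(r in A) (fisher_pdf mu (posterior_parameter F Fz z) r)%:E *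
     (measurement_pdf mu F Fz z)%:E).
Proof.
move=> mA mB.
(* The event is rewritten in terms of the independent pair [(X, W)]. *)
pose S := [set p : SO3 R * SO3 R | A p.1 /\ B (p.1 * p.2)%g].
have mS : measurable S.
  have -> : S = (fst @^-1` A) `&` ((fun p => (p.1 * p.2)%g) @^-1` B) by [].
  apply: measurableI; rewrite -[X in measurable X]setTI.
    exact: measurable_fst.
  exact: measurable_SO3_mul.
have -> : X @^-1` A `&` Z @^-1` B = [set w | S (X w, W w)].
  by apply/seteqP; split=> w /=; rewrite /S /= /preimage /= hZ.
rewrite (independent_RV_joint hXW mS).
(* The likelihood: the density at [p.2] of the measurement when the true attitude is [p.1]. *)
pose f (p : SO3 R * SO3 R) := (fisher_pdf mu Fz (p.1^-1 * p.2)%g)%:E.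
have mf : measurable_fun setT f.
  apply/measurable_EFinP.
  apply: (measurableT_comp (measurable_fisher_pdf mu Fz)).
  apply: (measurableT_comp (@measurable_SO3_mul R)
    (g := fun p : SO3 R * SO3 R => ((p.1^-1)%g : SO3 R, p.2))).
  apply: measurable_fun_pair => //.
  exact: (measurableT_comp (@measurable_SO3_inv R) measurable_fst).
have f0 p : 0 <= f p by rewrite lee_fin fisher_pdf_ge0.
(* The section of [S] at [r] is empty unless [r] lies in [A], and then it is the set of [w] with
   [r w] in [B]. Left translation by [r] turns its probability under [W] into the integral of the
   likelihood over [B]. *)
transitivity (\int[distribution P X]_(r in A) \int[mu]_(z in B) f (r, z)).
  rewrite [RHS]integral_mkcond; apply: eq_integral => r _; rewrite patchE.
  case: ifPn => rA; last first.
    rewrite (_ : xsection S r = set0) ?measure0//.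
    apply/seteqP; split=> // w; rewrite /xsection /= inE => -[Ar _].
    by move: rA; rewrite notin_setE.
  rewrite -(haar_integral_mull r (f := fun z => f (r, z)) hmu mB)//; last first.
    exact: measurable_fun_pair2.
  have -> : xsection S r = [set w | B (r * w)%g].
    apply/seteqP; split=> w; rewrite /xsection /= inE; first by case.
    by split=> //; move: rA; rewrite inE.
  rewrite hW; last first.
    rewrite -[X in measurable X]setTI.
    exact: (measurable_fun_pair2 r (@measurable_SO3_mul R)).
  by apply: eq_integral => w _; rewrite /f /= mulKg.
rewrite (ge0_integral_density (mu := mu)
  (g := EFin \o fisher_pdf mu F))//; last 4 first.
- by apply/measurable_EFinP; exact: measurable_fisher_pdf.
- by move=> r; rewrite lee_fin fisher_pdf_ge0.
- by apply: measurable_funTS; exact: measurable_fun_integral_section.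
- by move=> r; exact: integral_ge0.
pose h p := f p * (fisher_pdf mu F p.1)%:E.
transitivity (\int[mu]_(r in A) \int[mu]_(z in B) h (r, z)).
  apply: eq_integral => r _; rewrite -ge0_integralZr//.
    by apply: measurable_funTS; exact: measurable_fun_pair2.
  by rewrite lee_fin fisher_pdf_ge0.
(* With [z] now the outer variable, the Bayes identity splits off a factor independent of [r]. *)
rewrite fubini_tonelli_rectangle//; last 2 first.
- apply: emeasurable_funM => //; apply/measurable_EFinP.
  exact: (measurableT_comp (measurable_fisher_pdf mu F) measurable_fst).
- by move=> p; rewrite mule_ge0// lee_fin fisher_pdf_ge0.
apply: eq_integral => z _; rewrite -ge0_integralZr//.
- by apply: eq_integral => r _; rewrite -EFinM -fisher_pdf_bayes EFinM.
- by apply/measurable_funTS/measurable_EFinP; exact: measurable_fisher_pdf.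
- by move=> r _; rewrite lee_fin fisher_pdf_ge0.
- by rewrite lee_fin measurement_pdf_ge0.
Qed.

(** In the joint law, take [A] to be the whole group: the posterior density integrates to 1 in
    [r]. *)
Lemma measurement_law B : measurable B ->
  distribution P Z B = \int[mu]_(z in B) (measurement_pdf mu F Fz z)%:E.
Proof.
move=> mB; have := joint_law_measurement measurableT mB.
rewrite preimage_setT setTI /distribution /pushforward => ->.
apply: eq_integral => z _.
by rewrite integral_fisher_pdf mul1e.
Qed.

End bayes.

Local Close Scope ereal_scope.

Theorem mainTheorem4 (R : realType) (mu : probability (SO3 R) R)
    (hmu : is_haar mu) (F Fz : 'M[R]_3)
    (d : measure_display) (Omega : measurableType d) (P : probability Omega R)
    (X W Z : {RV P >-> SO3 R})
    (hX : matrix_fisher mu F (distribution P X))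
    (hW : matrix_fisher mu Fz (distribution P W))
    (hXW : independent_RV X W)
    (hZ : forall w : Omega, Z w = (X w * W w)%g) :
  exists K : R.-pker (SO3 R) ~> (SO3 R),
    conditional_distribution X Z K /\
    forall z : SO3 R, matrix_fisher mu (F + SO3_mx z *m Fz^T) (K z).
Proof.
have [K KE] : exists K : R.-pker (SO3 R) ~> (SO3 R), forall z A,
    K z A =
    (\int[mu]_(r in A) (fisher_pdf mu (posterior_parameter F Fz z) r)%:E)%E.
  apply: (density_pkernel (f := fun zr : SO3 R * SO3 R =>
    (fisher_pdf mu (posterior_parameter F Fz zr.1) zr.2)%:E)).
  - by apply/measurable_EFinP; exact: measurable_fisher_pdf_posterior.
  - by move=> zr; rewrite lee_fin fisher_pdf_ge0.
  - move=> z; rewrite -(integral_fisher_pdf mu (posterior_parameter F Fz z)).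
    exact: eq_integral.
exists K; split=> [A B mA mB|z A mA]; last exact: KE.
rewrite (joint_law_measurement hmu hX hW hXW hZ)//.
(* Passing from the law of [Z] to its density [measurement_pdf] turns the integral of [K z A] into
   the formula for the joint law. *)
rewrite (ge0_integral_density (mu := mu) (nu := distribution P Z)
  (g := EFin \o measurement_pdf mu F Fz))//.
- by apply: eq_integral => z _; rewrite KE.
- by apply/measurable_EFinP; exact: measurable_measurement_pdf.
- by move=> z; rewrite lee_fin measurement_pdf_ge0.
- by move=> C mC; exact: (measurement_law hmu hX hW hXW hZ).
- by apply: measurable_funTS; exact: measurable_kernel.
Qed.
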